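(* Let $T\subseteq S$ and let $G=A_m$, $m\ge1$, be an alternating group. If there exists $n_0\in\mathbb{N}$ such that $\langle S_n(T)\rangle\cong G$ for every $n\ge n_0$, then $m\le 2$.
   Context: $S_n$ is the symmetric group on $[n]$, $S=\bigcup_{n\ge0}S_n$, and $A_m$ is the alternating group of even permutations of $[m]$. A permutation $\pi\in S_n$ contains the pattern $\tau\in S_k$ if some subsequence of $\pi$ of length $k$ is order-isomorphic to $\tau$; otherwise it avoids $\tau$. For $T\subseteq S$, $S_n(T)$ is the set of permutations in $S_n$ avoiding every pattern in $T$, and $\langle S_n(T)\rangle$ is the subgroup of $S_n$ it generates. *)

(* Defs.v *)
From mathcomp Require Import all_boot all_fingroup all_solvable.
From mathcomp Require Import boolp classical_sets.

Set Implicit Arguments.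
Unset Strict Implicit.
Unset Printing Implicit Defensive.

(* The disjoint union of the 'S_k, so that a pattern carries its length;
   one-line notation is i |-> pi i, with positions and values numbered from 0. *)
Definition permutation : Type := {k : nat & 'S_k}.

Definition contains (n k : nat) (pi : 'S_n) (tau : 'S_k) : Prop :=
  exists f : 'I_k -> 'I_n,
    (forall a b : 'I_k, a < b -> f a < f b) /\
    (forall a b : 'I_k, (pi (f a) < pi (f b)) = (tau a < tau b)).

Definition avoids (n k : nat) (pi : 'S_n) (tau : 'S_k) : Prop :=
  ~ contains pi tau.

(* The class S_n(T). *)
Definition avoiders (T : set permutation) (n : nat) : {set 'S_n} :=
  [set pi : 'S_n | `[< forall tau : permutation, T tau -> avoids pi (tagged tau) >]]%SET.

(* Main.v *)
(* The alternating group is generated by elements of cube 1, so all elements of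
   <S_n(T)> are even for n >= n0.  Deleting position i from pi changes the sign by
   (-1)^(i + pi i); hence pi i = i mod 2 for every i when pi has length > n0.  This
   applies to pi and to its one-point deletions once n >= n0 + 2, and comparing the
   parities before and after deleting i shows that no pair {i, j} is an inversion.
   So S_n(T) is contained in {1}, and A_m is trivial. *)
Require Import Defs.
From mathcomp Require Import all_boot all_fingroup all_solvable.
From mathcomp Require Import boolp classical_sets.

(** For [x = z] the product is 1. Otherwise, with a and b the two factors, the braid relation aba =
    bab = [tperm x z] gives (ab)^3 = (aba)(bab) = 1. *)
Lemma tperm_mul_cube (aT : finType) (x y z : aT) :
  x != y -> y != z -> ((tperm x y * tperm y z) ^+ 3 = 1)%g.
Proof.
move=> nxy nyz; have [<-|nxz] := eqVneq x z.
  by rewrite (tpermC y x) tperm2 expg1n.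
have aba : (tperm x y * tperm y z * tperm x y = tperm x z)%g.
  have := tpermJ y z (tperm x y).
  by rewrite /conjg tpermV tpermR tpermD // mulgA.
have bab : (tperm y z * tperm x y * tperm y z = tperm x z)%g.
  have := tpermJ x y (tperm y z).
  by rewrite /conjg tpermV tpermL tpermD 1?eq_sym // mulgA.
by rewrite !expgS expg0 mulg1 !mulgA aba -!mulgA (mulgA (tperm y z)) bab tperm2.
Qed.

Lemma odd_perm_cube1 (aT : finType) (s : {perm aT}) : (s ^+ 3 = 1)%g -> ~~ odd_perm s.
Proof.
move=> s3; have := odd_perm1 aT; rewrite -s3 !expgS expg0 mulg1 !odd_permM.
by case: (odd_perm s).
Qed.

(** An even permutation is a product of pairs of transpositions. A pair sharing a point has cube 1,
    hence so does its image, and the sign of a cube is the sign itself. *)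
Lemma Alt_morphism_even (aT rT : finType) (f : {morphism ('Alt_aT)%g >-> {perm rT}}) x :
  x \in ('Alt_aT)%g -> ~~ odd_perm (f x).
Proof.
have even_tperm2 a b c d : a != b -> c != d ->
    (tperm a b * tperm c d)%g \in ('Alt_aT)%g /\ ~~ odd_perm (f (tperm a b * tperm c d)%g).
  have even_adj u v w : u != v -> v != w ->
      (tperm u v * tperm v w)%g \in ('Alt_aT)%g /\ ~~ odd_perm (f (tperm u v * tperm v w)%g).
    move=> nuv nvw; have Alt_uvw : (tperm u v * tperm v w)%g \in ('Alt_aT)%g.
      by rewrite Alt_even odd_permM !odd_tperm nuv nvw.
    split=> //; apply: odd_perm_cube1.
    by rewrite -morphX // tperm_mul_cube // morph1.
  move=> nab ncd; case: (eqVneq b c) ncd => [<-|nbc] ncd; first exact: even_adj.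
  have [Alt1 even1] := even_adj a b c nab nbc.
  have [Alt2 even2] := even_adj b c d nbc ncd.
  (* Inserting [tperm b c] twice splits the pair into two pairs, each sharing a point. *)
  have -> : (tperm a b * tperm c d
      = (tperm a b * tperm b c) * (tperm b c * tperm c d))%g.
    by rewrite mulgA -(mulgA (tperm a b)) tperm2 mulg1.
  rewrite groupM // morphM // odd_permM; by rewrite (negPf even1) (negPf even2).
have [ts -> dts] := prod_tpermP x; rewrite Alt_even odd_perm_prod // => even_ts.
set y := (\prod_(t <- ts) _)%g.
suff: y \in ('Alt_aT)%g /\ ~~ odd_perm (f y) by case.
(* The induction is on a bound for the length, as transpositions are removed two at a time. *)
rewrite {}/y; have [k] := ubnP (size ts).
elim: k => // k IHk in ts dts even_ts *.
case: ts => [|t1 [|t2 ts]] // in dts even_ts *.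
  by rewrite big_nil group1 morph1 odd_perm1.
case/and3P: dts => nt1 nt2 dts; rewrite /= negbK in even_ts.
move=> /ltnW; rewrite /= !ltnS => le_ts; rewrite !big_cons mulgA.
have [Alt1 even1] := even_tperm2 _ _ _ _ nt1 nt2.
have [Alt2 even2] := IHk ts dts even_ts le_ts.
by rewrite groupM // morphM // odd_permM (negPf even1) (negPf even2).
Qed.

Lemma lift_perm_delete (n : nat) (pi : 'S_n.+1) (i : 'I_n.+1) :
  exists s : 'S_n, pi = lift_perm i (pi i) s.
Proof.
(* The default [k] is never taken: [pi (lift i k)] differs from [pi i] by injectivity. *)
have liftP k : lift (pi i) (odflt k (unlift (pi i) (pi (lift i k)))) = pi (lift i k).
  case: unliftP => [j -> //|/perm_inj/eqP]; by rewrite eq_sym (negPf (neq_lift i k)).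
have inj_s : injective (fun k => odflt k (unlift (pi i) (pi (lift i k)))).
  by move=> a b /(congr1 (lift (pi i))); rewrite !liftP => /perm_inj/lift_inj.
exists (perm inj_s); apply/permP=> k; case: (unliftP i k) => [j ->|->].
  by rewrite lift_perm_lift permE liftP.
by rewrite lift_perm_id.
Qed.

Lemma ltn_lift (n : nat) (h : 'I_n.+1) (a b : 'I_n) : (lift h a < lift h b) = (a < b).
Proof. by rewrite /= !ltnNge leq_bump2. Qed.

Lemma ltn_bump (h k : nat) : (h < bump h k) = (h <= k).
Proof. by rewrite /bump; case: (leqP h k) => [//|/ltnW le_kh]; rewrite ltnNge le_kh. Qed.

Lemma avoiders_lift_perm (T : set permutation) (n : nat) (i j : 'I_n.+1) (s : 'S_n) :
  lift_perm i j s \in avoiders T n.+1 -> s \in avoiders T n.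
Proof.
rewrite !inE => /asboolP av; apply/asboolP => tau /av navt [f [f_incr f_pat]].
apply: navt; exists (lift i \o f); split=> a b.
  by move=> /f_incr; rewrite /comp ltn_lift.
by rewrite /comp !lift_perm_lift ltn_lift f_pat.
Qed.

Lemma incr_perm_ge (n : nat) (s : 'S_n) :
  (forall i j : 'I_n, i < j -> s i < s j) -> forall i : 'I_n, i <= s i.
Proof.
move=> s_incr [i lt_in]; elim: i => // i IHi in lt_in *.
have := s_incr (Ordinal (ltnW lt_in)) (Ordinal lt_in) (ltnSn i).
exact: leq_ltn_trans (IHi (ltnW lt_in)).
Qed.

(** Both [s] and its inverse are increasing, so [i <= s i] and [s i <= i]. *)
Lemma incr_perm_eq1 (n : nat) (s : 'S_n) : (forall i j : 'I_n, (i < j) = (s i < s j)) -> s = 1%g.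
Proof.
move=> s_mono; apply/permP=> i; rewrite perm1; apply/val_inj/eqP; rewrite eqn_leq.
rewrite [_ <= s i]incr_perm_ge; last by move=> j k; rewrite s_mono.
rewrite andbT -{2}(permK s i); apply: incr_perm_ge => j k.
by rewrite -{1}(permKV s j) -{1}(permKV s k) -s_mono.
Qed.

Lemma avoiders_sub1 (T : set permutation) (n0 : nat) :
    (forall n, n0 <= n -> {in avoiders T n, forall s, ~~ odd_perm s}) ->
  forall n, n0 <= n -> avoiders T n.+2 \subset [1 'S_n.+2]%g.
Proof.
move=> even_av.
have fix_parity n (s : 'S_n.+1) i : n0 <= n -> s \in avoiders T n.+1 -> odd (s i) = odd i.
  move=> le_n av_s; have [t def_s] := lift_perm_delete n s i.
  have av_t : t \in avoiders T n by move: av_s; rewrite def_s => /avoiders_lift_perm.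
  have := even_av _ (leqW le_n) _ av_s; have := even_av _ le_n _ av_t.
  rewrite def_s odd_lift_perm lift_perm_id; by do 2!case: odd; case: odd_perm.
move=> n le_n; apply/fintype.subsetP=> s av_s; rewrite inE.
have s_mono (i j : 'I_n.+2) : (i < j) = (s i < s j).
  have [t def_s] := lift_perm_delete _ s i.
  have av_t : t \in avoiders T n.+1 by move: av_s; rewrite def_s => /avoiders_lift_perm.
  case: (unliftP i j) => [k ->|->]; last by rewrite !ltnn.
  (* Restoring the deleted point raises the position [k] by 1 iff [i <= k], and the value [t k] by 1
     iff [s i <= t k]. Position and value agree in parity before and after, so these conditions are
     equivalent. *)
  have := fix_parity _ _ (lift i k) (leqW le_n) av_s; have := fix_parity _ _ k le_n av_t.
  have -> : s (lift i k) = lift (s i) (t k) by rewrite {1}def_s lift_perm_lift.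
  rewrite /= !ltn_bump /bump !oddD => ->.
  by case: (i <= k); case: (s i <= t k); case: (odd k).
by apply/eqP/incr_perm_eq1.
Qed.

Theorem theorem5p5 (T : set permutation) (m : nat) (hm : 1 <= m)
    (h : exists n0 : nat, forall n : nat, n0 <= n ->
           (<<avoiders T n>> \isog 'Alt_('I_m))%g) :
  m <= 2.
Proof.
have [n0 isoG] := h.
have even_av n : n0 <= n -> {in avoiders T n, forall s, ~~ odd_perm s}.
  move=> /isoG; rewrite isog_sym => /isogP[f _ im_f] s /mem_gen.
  by rewrite -im_f => /morphimP[x Ax _ ->]; apply: Alt_morphism_even.
have := isoG n0.+2 (leqW (leqnSn n0)).
have -> : (<<avoiders T n0.+2>> = 1)%g.
  by apply/trivgP; rewrite gen_subG; apply: (avoiders_sub1 _ _ even_av _ (leqnn n0)).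
move=> /card_isog; rewrite cards1 => card1.
(* If [2 < m], a trivial alternating group would give m! = 2, against m! >= m > 2. *)
rewrite leqNgt; apply/negP=> lt2m; have := @card_Alt 'I_m.
rewrite -card1 card_ord => /(_ (ltnW lt2m)) fact2.
by have := fact_geq m; rewrite -fact2 leqNgt lt2m.
Qed.
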